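(* Let $w$ be a Sturmian word (equivalently, an irrational mechanical word) with slope $\alpha$. Then $\mathrm{PNF}_1(w)=1c_{\alpha}$ and $\mathrm{PNF}_0(w)=0c_{\alpha}$, where $c_\alpha$ is the characteristic word of slope $\alpha$.
   Context: Binary words are indexed from $1$. An infinite binary word is Sturmian if it is balanced (any two factors of equal length differ in number of $1$s by at most $1$) and not ultimately periodic; its slope $\alpha=\lim_{i\to\infty}P_w(i)/i$ exists and is irrational, where $P_w(i)$ is the number of $1$s in the prefix of length $i$. For irrational $\alpha\in(0,1)$, $c_\alpha(n)=\lfloor\alpha(n+1)\rfloor-\lfloor\alpha n\rfloor$ for $n\ge1$. $F^1_w(i)$ (resp. $F^0_w(i)$) is the maximum number of $1$s (resp. $0$s) in a factor of $w$ of length $i$, with $F^a_w(0)=0$. The prefix normal forms are $\mathrm{PNF}_1(w)=w'$, $\mathrm{PNF}_0(w)=w''$ with $w'_n=F^1_w(n)-F^1_w(n-1)$ and $w''_n=1-(F^0_w(n)-F^0_w(n-1))$ for $n\ge1$. *)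

(* Defs.v *)
From mathcomp Require Import all_boot all_order all_algebra.
From mathcomp Require Import all_classical all_reals all_analysis.

Set Implicit Arguments.
Unset Strict Implicit.
Unset Printing Implicit Defensive.

Import Order.TTheory GRing.Theory Num.Theory.
Import numFieldNormedType.Exports.

Local Open Scope classical_set_scope.
Local Open Scope ring_scope.

(* An infinite word x_1 x_2 x_3 ... is a function on nat whose value at i is   *)
(* the letter x_(i+1). Binary words have letters in bool (true is 1, false is  *)
(* 0); words given by arithmetic formulas have letters in int.                 *)
Definition word (A : Type) := nat -> A.

Definition wcons (A : Type) (a : A) (x : word A) : word A :=
  fun i => if i is j.+1 then x j else a.

(* The factor w_(k+1) ... w_(k+n). *)
Definition factor (w : word bool) (k n : nat) : seq bool :=
  mkseq (fun j => w (k + j)%N) n.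

Definition balanced (w : word bool) : Prop :=
  forall n k l : nat,
    `|(count_mem true (factor w k n))%:Z
      - (count_mem true (factor w l n))%:Z| <= 1.

Definition ultimately_periodic (A : Type) (x : word A) : Prop :=
  exists N p : nat,
    (0 < p)%N /\ forall n : nat, (N <= n)%N -> x (n + p)%N = x n.

Definition sturmian (w : word bool) : Prop :=
  balanced w /\ ~ ultimately_periodic w.

Definition prefix_ones (w : word bool) (i : nat) : nat :=
  count_mem true (factor w 0 i).

Definition slope (R : realType) (w : word bool) : R :=
  lim ((fun i : nat => (prefix_ones w i)%:R / i%:R : R) @ \oo).

(* F^a_w(n): the occurrence counts of a in factors of length n form a nonempty *)
(* subset of {0, ..., n}, and this is its largest element.                     *)
Definition max_count (a : bool) (w : word bool) (n : nat) : nat :=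
  (\max_(m < n.+1 | `[< exists k : nat, count_mem a (factor w k n) = m >]) m)%N.

Definition PNF1 (w : word bool) : word int :=
  fun i => (max_count true w i.+1)%:Z - (max_count true w i)%:Z.

Definition PNF0 (w : word bool) : word int :=
  fun i => 1 - ((max_count false w i.+1)%:Z - (max_count false w i)%:Z).

(* c_alpha(n) = floor (alpha (n + 1)) - floor (alpha n) with n = i + 1 >= 1.   *)
Definition characteristic_word (R : realType) (alpha : R) : word int :=
  fun i => Num.floor (alpha * i.+2%:R) - Num.floor (alpha * i.+1%:R).

(* Main.v *)
(** Write [m n] and [M n] for the least and greatest number of 1s in a factor
    of length [n].  Cutting a prefix of length [n * l] into blocks of length
    [n], or into blocks of length [l], gives [m n / n <= M l / l]; together with
    balance, [M n <= m n + 1], this forces the slope [alpha] to exist and to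
    satisfy [m n <= alpha n <= M n].  If [alpha n = M n] with [n > 0], balance
    bounds the total deficit of consecutive blocks of length [n] by 1, so that
    in each residue class mod [n] at most one block has fewer than [M n] ones,
    and [w] is ultimately periodic.  Hence [m n <= alpha n < M n <= m n + 1],
    that is, [m n = floor (alpha n)] and [M n = floor (alpha n) + 1]. *)

Require Import Defs.
From mathcomp Require Import all_boot all_order all_algebra.
From mathcomp Require Import all_classical all_reals all_analysis.
From mathcomp Require Import zify lra.

Import Order.TTheory GRing.Theory Num.Theory.
Import numFieldNormedType.Exports.

Local Open Scope classical_set_scope.
Local Open Scope ring_scope.

Section FactorCounts.
Variable w : word bool.
Local Open Scope nat_scope.

Local Notation count_factor a k n := (count_mem a (Defs.factor w k n)).

(** The [m n] of the overview: a factor with the most 0s has the fewest 1s. Encoding it through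
    [max_count false] lets one quantity serve both normal forms. *)
Definition min_ones (n : nat) : nat := n - max_count false w n.

Lemma count_factor_cat a k m n :
  count_factor a k (m + n) = count_factor a k m + count_factor a (k + m) n.
Proof.
rewrite /Defs.factor /mkseq iotaD map_cat count_cat add0n; congr (_ + _).
rewrite -[in LHS](addn0 m) iotaDl -map_comp; congr (count _ _).
by apply: eq_map => j /=; rewrite addnA.
Qed.

Lemma count_factor1 k : count_factor true k 1 = w k.
Proof. by rewrite /Defs.factor /= addn0 addn0; case: (w k). Qed.

Lemma count_factor_compl k n :
  count_factor true k n + count_factor false k n = n.
Proof.
rewrite -[RHS](size_mkseq (fun j => w (k + j)) n) -/(Defs.factor w k n).
by elim: (Defs.factor w k n) => //= -[] s IHs /=; lia.
Qed.

Lemma count_factor_le_max a k n : count_factor a k n <= max_count a w n.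
Proof.
have lt_c : count_factor a k n < n.+1.
  by rewrite ltnS -[leqRHS](size_mkseq (fun j => w (k + j)) n) count_size.
rewrite /max_count.
apply: (@leq_bigmax_cond _ _ (fun m : 'I_n.+1 => m : nat) (Ordinal lt_c)).
by apply/asboolP; exists k.
Qed.

Lemma max_count_attained a n : exists k, count_factor a k n = max_count a w n.
Proof.
have [[k Hk]|no] := pselect (exists k, max_count a w n <= count_factor a k n).
  by exists k; apply/eqP; rewrite eqn_leq count_factor_le_max Hk.
(* If every count were below the maximum, the maximum would be at most its own predecessor, hence 0;
   but the factor at position 0 makes it positive. *)
exfalso; have : max_count a w n <= (max_count a w n).-1.
  rewrite {1}/max_count; apply/bigmax_leqP => i /asboolP[k <-].
  have : ~~ (max_count a w n <= count_factor a k n) by apply/negP => ?; apply: no; exists k.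
  lia.
have : ~~ (max_count a w n <= count_factor a 0 n) by apply/negP => ?; apply: no; exists 0.
lia.
Qed.

Lemma max_count_le a n : max_count a w n <= n.
Proof.
have [k <-] := max_count_attained a n.
by rewrite -[leqRHS](size_mkseq (fun j => w (k + j)) n) count_size.
Qed.

Lemma min_ones_le k n : min_ones n <= count_factor true k n.
Proof.
rewrite /min_ones; have := count_factor_compl k n.
by have := count_factor_le_max false k n; lia.
Qed.

Lemma min_ones_attained n : exists k, count_factor true k n = min_ones n.
Proof.
have [k Hk] := max_count_attained false n; exists k.
by rewrite /min_ones -Hk; have := count_factor_compl k n; lia.
Qed.

Lemma count_blocks_le k q n : count_factor true k (q * n) <= q * max_count true w n.
Proof.
elim: q k => [|q IH] k //; rewrite !mulSn count_factor_cat.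
by apply: leq_add; [exact: count_factor_le_max | exact: IH].
Qed.

Lemma count_blocks_ge k q n : q * min_ones n <= count_factor true k (q * n).
Proof.
elim: q k => [|q IH] k //; rewrite !mulSn count_factor_cat.
by apply: leq_add; [exact: min_ones_le | exact: IH].
Qed.

Lemma min_ones_cross_max n l : l * min_ones n <= n * max_count true w l.
Proof.
by apply: leq_trans (count_blocks_ge 0 l n) _; rewrite mulnC; exact: count_blocks_le.
Qed.

Lemma balanced_max_le : balanced w -> forall n, max_count true w n <= (min_ones n).+1.
Proof.
move=> bal n; have [k <-] := max_count_attained true n.
by have [l <-] := min_ones_attained n; have := bal n k l; lia.
Qed.

(* Two deficient blocks with only whole blocks between them would lower a count by 2. *)
Lemma blocks_eventually_full n r :
    (forall q k, q * max_count true w n <= (count_factor true k (q * n)).+1) ->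
  exists N, forall j, N <= j -> count_factor true (r + j * n) n = max_count true w n.
Proof.
move=> full.
have [[i def_i]|no] :=
    pselect (exists i, count_factor true (r + i * n) n < max_count true w n); last first.
  exists 0 => j _; apply/eqP; rewrite eqn_leq count_factor_le_max leqNgt.
  by apply/negP => ?; apply: no; exists j.
exists i.+1 => j /subnKC <-; set d := j - i.+1.
have := full d.+2 (r + i * n).
rewrite (_ : d.+2 * n = n + (d * n + n)) ?count_factor_cat; last by rewrite !mulSn; lia.
have -> : r + i * n + n + d * n = r + (i.+1 + d) * n by rewrite mulnDl mulSn; lia.
have := count_factor_le_max true (r + (i.+1 + d) * n) n.
have := count_blocks_le (r + i * n + n) d n.
by rewrite !mulSn; lia.
Qed.

(** Beyond a threshold common to the [n] residue classes, all windows of length [n] have the same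
    count. Sliding a window by one letter loses [w k] and gains [w (k + n)], so these letters
    agree. *)
Lemma full_blocks_periodic n : 0 < n ->
    (forall q k, q * max_count true w n <= (count_factor true k (q * n)).+1) ->
  ultimately_periodic w.
Proof.
move=> n_gt0 full.
have /choice[N HN] := fun r => @blocks_eventually_full n r full.
(* Each [N r] counts blocks, so the threshold as a position is [K * n]. *)
pose K := \max_(r < n) N r.
have const k : K * n <= k -> count_factor true k n = max_count true w n.
  move=> leKk; rewrite (divn_eq k n) addnC; apply: HN.
  apply: (@leq_trans K); last by rewrite leq_divRL.
  exact: (@leq_bigmax _ (fun r : 'I_n => N r) (Ordinal (ltn_pmod k n_gt0))).
exists (K * n), n; split=> // k leKk.
have := count_factor_cat true k n 1; rewrite addn1 -[n.+1]add1n count_factor_cat.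
rewrite !count_factor1 (const k leKk) (const (k + 1)); last by lia.
by case: (w k); case: (w (k + n)); lia.
Qed.

End FactorCounts.

Section Slope.
Variables (R : realType) (w : word bool).
Hypothesis w_balanced : balanced w.

(** Every ratio [max_count true w l / l] bounds every ratio [min_ones w n / n] from above, so the
    supremum of the latter separates the two families; the slope is shown to be this supremum. *)
Lemma balanced_slope_bounds n :
  (min_ones w n)%:R <= slope R w * n%:R <= (max_count true w n)%:R.
Proof.
pose E : set R := [set x | exists n, x = (min_ones w n.+1)%:R / n.+1%:R].
have E_ub l : ubound E ((max_count true w l.+1)%:R / l.+1%:R).
  move=> _ [k ->]; rewrite ler_pdivrMr ?ltr0n // mulrAC ler_pdivlMr ?ltr0n //.
  by rewrite -!natrM ler_nat mulnC [leqRHS]mulnC; exact: min_ones_cross_max.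
have E_sup : has_sup E.
  by split; [exists ((min_ones w 1)%:R / 1), 0%N | exists ((max_count true w 1)%:R / 1); exact: E_ub].
have supE_ge l : (min_ones w l)%:R <= sup E * l%:R.
  case: l => [|l]; first by rewrite mulr0 /min_ones sub0n.
  by rewrite -ler_pdivrMr ?ltr0n //; apply: sup_upper_bound => //; exists l.
have supE_le l : sup E * l%:R <= (max_count true w l)%:R.
  case: l => [|l]; first by rewrite mulr0.
  by rewrite -ler_pdivlMr ?ltr0n //; apply: ge_sup; [case: E_sup | exact: E_ub].
suff -> : slope R w = sup E by rewrite supE_ge supE_le.
apply: cvg_lim => //; rewrite -cvg_shiftS.
(* Both [p] and [sup E * i.+1] lie between [min_ones] and [max_count], which differ by at most 1.
   Dividing by [i.+1] gives the error [harmonic i]. *)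
apply: (@squeeze_cvgr _ _ _ _ (fun i => sup E - harmonic i) (fun i => sup E + harmonic i)).
- near=> i; set p := prefix_ones w i.+1.
  have le_p : (min_ones w i.+1)%:R <= p%:R :> R by rewrite ler_nat min_ones_le.
  have p_le : p%:R <= (max_count true w i.+1)%:R :> R by rewrite ler_nat count_factor_le_max.
  have : (max_count true w i.+1)%:R <= (min_ones w i.+1)%:R + 1 :> R.
    by rewrite natr1 ler_nat balanced_max_le.
  have := supE_ge i.+1; have := supE_le i.+1 => ? ? ?.
  rewrite /harmonic /= ler_pdivlMr ?ltr0n // ler_pdivrMr ?ltr0n //.
  rewrite mulrBl mulrDl mulVf ?pnatr_eq0 //; lra.
- rewrite -[X in _ --> X]subr0; apply: cvgB; [exact: cvg_cst | exact: cvg_harmonic].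
- rewrite -[X in _ --> X]addr0; apply: cvgD; [exact: cvg_cst | exact: cvg_harmonic].
Unshelve. all: by end_near. Qed.

Hypothesis w_aperiodic : ~ ultimately_periodic w.

Lemma sturmian_slope_lt_max n : (0 < n)%N ->
  slope R w * n%:R < (max_count true w n)%:R.
Proof.
move=> n_gt0; have /andP[_ le_max] := balanced_slope_bounds n.
rewrite lt_neqAle le_max andbT; apply/eqP => eq_max; apply: w_aperiodic.
apply: (full_blocks_periodic w n n_gt0) => q k.
(* Under the assumed equality, [q * max_count true w n] is the slope times [q * n], hence at most
   the maximum for length [q * n], which balance keeps within 1 of any count. *)
apply: (@leq_trans (max_count true w (q * n))).
  rewrite -(ler_nat R) natrM -eq_max mulrCA -natrM.
  by have /andP[] := balanced_slope_bounds (q * n).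
apply: leq_trans (balanced_max_le w w_balanced _) _.
by rewrite ltnS min_ones_le.
Qed.

Lemma sturmian_max_ones n : (0 < n)%N ->
  (max_count true w n)%:Z = Num.floor (slope R w * n%:R) + 1 /\
  (max_count false w n)%:Z = n%:Z - Num.floor (slope R w * n%:R).
Proof.
move=> n_gt0; have /andP[ge_min _] := balanced_slope_bounds n.
have lt_max := sturmian_slope_lt_max n n_gt0.
have max_le := balanced_max_le w w_balanced n.
have min_lt : (min_ones w n < max_count true w n)%N.
  by rewrite -(ltr_nat R); exact: le_lt_trans lt_max.
have def_max : max_count true w n = (min_ones w n).+1 by lia.
have -> : Num.floor (slope R w * n%:R) = (min_ones w n)%:Z.
  apply: floor_def; rewrite -pmulrn ge_min /=.
  by rewrite -[_ + 1]/((min_ones w n)%:Z + 1%:Z) -PoszD addn1 -pmulrn -def_max.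
split; first by rewrite def_max; lia.
by have := max_count_le w false n; rewrite /min_ones; lia.
Qed.

(** A single letter holds at most one 1 and at most one 0; the two formulas at length 1 then bound
    the floor from above and from below by 0. This fixes the first letters of the normal forms. *)
Lemma sturmian_floor_slope : Num.floor (slope R w * 1%:R) = 0.
Proof.
have [] := sturmian_max_ones 1 isT.
by have := max_count_le w true 1; have := max_count_le w false 1; lia.
Qed.

End Slope.

Theorem theorem5 (R : realType) (w : word bool) (alpha : R)
    (w_sturmian : sturmian w) (alpha_slope : alpha = slope R w) :
  PNF1 w = wcons 1 (characteristic_word alpha) /\
  PNF0 w = wcons 0 (characteristic_word alpha).
Proof.
case: w_sturmian => bal aper; rewrite alpha_slope.
have counts := sturmian_max_ones R w bal aper.
(* Length 0 is separate: the formula floor plus 1 would give 1 there instead of 0. At later letters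
   the added 1s cancel. *)
have count0 a : max_count a w 0 = 0%N by have := max_count_le w a 0; lia.
split; apply/funext => -[|i]; rewrite /PNF1 /PNF0 /wcons /characteristic_word.
- by rewrite count0 (counts 1%N isT).1 sturmian_floor_slope.
- by rewrite (counts i.+2 isT).1 (counts i.+1 isT).1; lia.
- by rewrite count0 (counts 1%N isT).2 sturmian_floor_slope.
- by rewrite (counts i.+2 isT).2 (counts i.+1 isT).2; lia.
Qed.
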